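(* Let $x_1,\dots,x_{2m}$ be indeterminates over $\mathbb{Z}$ with $m\geqslant3$, and set $R=\mathbb{Z}[x_1,\dots,x_{2m}]/\big(\sum_{i=1}^mx_ix_{m+i}\big)$. Then for each prime integer $p>0$, the Frobenius trace on $R/pR$ does not lift to a differential operator on $R/p^2R$, nor, a fortiori, to a differential operator on $R$.
   Context: Differential operators on a commutative ring are in Grothendieck's sense (additive maps such that, inductively, commutators with multiplication maps have lower order). A differential operator on $R/pR$ lifts to $R/p^2R$ (resp. $R$) if it is induced modulo $p$ by a differential operator on $R/p^2R$ (resp. $R$). Frobenius trace: for a field $K$ of characteristic $p$, $S=K[x_1,\dots,x_N]$ and $g\in S$ nonzero homogeneous, let $\partial_a$ be the $K$-linear map $x^b\mapsto\prod\binom{b_i}{a_i}x^{b-a}$ and $\Phi_S=\partial_{p-1,\dots,p-1}$ (mapping $S$ into $S^p$); the composite $S\xrightarrow{g^{p-1}}S\xrightarrow{\Phi_S}S^p\to(S/(g))^p$ kills $gS$, and the induced map $S/(g)\to(S/(g))^p$ is the Frobenius trace of $S/(g)$. It is applied to $R/pR$ over $K=\mathbb{Z}/p\mathbb{Z}$. *)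

(* Defs.v *)
From HB Require Import structures.
From mathcomp Require Import all_boot all_order all_algebra.
From mathcomp Require Import generic_quotient ring_quotient.
From mathcomp Require Import mpoly.
From Stdlib Require Import Classical ClassicalEpsilon.

Set Implicit Arguments.
Unset Strict Implicit.
Unset Printing Implicit Defensive.

Import GRing.Theory.
Local Open Scope ring_scope.
Local Open Scope quotient_scope.

(* Grothendieck differential operators on a commutative ring R         *)
(* (absolute, i.e. over Z: additive maps).                             *)
Fixpoint diffop_of_order (R : comPzRingType) (n : nat) (d : R -> R) : Prop :=
  (forall x y : R, d (x + y) = d x + d y) /\
  match n with
  | 0 => forall r x : R, d (r * x) = r * d x
  | n'.+1 => forall r : R, diffop_of_order n' (fun x => d (r * x) - r * d x)
  end.

Definition is_diffop (R : comPzRingType) (d : R -> R) : Prop :=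
  exists n, diffop_of_order n d.

Section Quadric.
Variables (A : comNzRingType) (m : nat).

Definition quadric : {mpoly A[m + m]} :=
  \sum_(i < m) 'X_(lshift m i) * 'X_(rshift m i).

Definition quadric_ideal : {mpoly A[m + m]} -> bool :=
  fun g => if excluded_middle_informative (exists h, g = h * quadric)
           then true else false.

Lemma quadric_idealP g : reflect (exists h, g = h * quadric) (quadric_ideal g).
Proof.
rewrite /quadric_ideal; case: excluded_middle_informative => H.
  by apply: ReflectT. by apply: ReflectF.
Qed.

Lemma quadric_eval0 : quadric.@[fun _ => 0] = 0.
Proof.
rewrite /quadric raddf_sum /=; apply: big1 => i _.
by rewrite mevalM !mevalXU mulr0.
Qed.

Lemma quadric_ideal_closed : idealr_closed quadric_ideal.
Proof.
split.
- by apply/quadric_idealP; exists 0; rewrite mul0r.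
- apply/quadric_idealP => -[h /(congr1 (meval (fun _ => 0)))].
  rewrite meval1 mevalM quadric_eval0 mulr0 => /eqP; by rewrite oner_eq0.
- move=> a u v /quadric_idealP[hu ->] /quadric_idealP[hv ->].
  by apply/quadric_idealP; exists (a * hu + hv); rewrite mulrDl mulrA.
Qed.

End Quadric.

Arguments quadric : clear implicits.
Arguments quadric_ideal : clear implicits.

HB.instance Definition _ (A : comNzRingType) (m : nat) :=
  isIdealr.Build _ (quadric_ideal A m) (@quadric_ideal_closed A m).

Definition quadric_ring (A : comNzRingType) (m : nat) :=
  {ideal_quot (quadric_ideal A m : idealr _)}.

Arguments quadric_ring : clear implicits.

Definition reduce_int (p m : nat) (a : quadric_ring int m) : quadric_ring 'Z_p m :=
  \pi_(quadric_ring 'Z_p m) (map_mpoly (fun c : int => c%:~R : 'Z_p) (repr a)).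

Definition reduce_sq (p m : nat) (a : quadric_ring 'Z_(p ^ 2) m)
  : quadric_ring 'Z_p m :=
  \pi_(quadric_ring 'Z_p m) (map_mpoly (fun c : 'Z_(p ^ 2) => (val c)%:R : 'Z_p) (repr a)).

Definition hasse_partial (K : comNzRingType) (N : nat) (a : 'X_{1..N})
  (s : {mpoly K[N]}) : {mpoly K[N]} :=
  \sum_(b <- msupp s)
     (s@_b * (\prod_(i < N) 'C(b i, a i))%:R) *: 'X_[mnm_sub b a].

Definition Phi (p N : nat) (s : {mpoly 'Z_p[N]}) : {mpoly 'Z_p[N]} :=
  hasse_partial [multinom p.-1 | i < N] s.

Arguments Phi : clear implicits.

(* Frobenius trace of R/pR = (Z/p)[x_1..x_{2m}]/(f), as a map R/pR -> R/pR
   (with values in (R/pR)^p, viewed inside R/pR). *)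
Definition frobenius_trace (p m : nat) (a : quadric_ring 'Z_p m)
  : quadric_ring 'Z_p m :=
  \pi_(quadric_ring 'Z_p m) (Phi p (m + m) (quadric 'Z_p m ^+ p.-1 * repr a)).

Arguments reduce_int : clear implicits.
Arguments reduce_sq : clear implicits.
Arguments frobenius_trace : clear implicits.

(* Main.v *)
Require Import Defs.
From HB Require Import structures.
From mathcomp Require Import all_boot all_order all_algebra.
From mathcomp Require Import generic_quotient ring_quotient.
From mathcomp Require Import mpoly.
From mathcomp Require Import zify.

Set Implicit Arguments.
Unset Strict Implicit.
Unset Printing Implicit Defensive.

Import GRing.Theory.
Local Open Scope ring_scope.
Local Open Scope quotient_scope.

(* Write the quadric as f = x_1 w_1 + ... + x_m w_m, and let d be a lift of
   order n of the Frobenius trace.  Put q = p^(n+2): modulo p^2, d commutes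
   with multiplication by every x_i^q.  For j in N^m let T(j) in Z/p^2 be the
   coefficient of (x_1...x_m)^(q-p) in d(prod_i x_i^(q-p+j_i) w_i^(j_i)); it is
   well defined because f vanishes at w = 0.  Then
   - T(j) = 0 as soon as some j_i = p, since x_i^q can be pulled out of d;
   - sum_i T(j + e_i) = 0, since f = 0 in R.
   Fixing all but three of the j_i to be p - 1, these two rules force
   p T(p-1, p-1, 0, p-1, ..., p-1) = 0, so this value is 0 modulo p.  But the
   formula for the trace gives binom(q-1, p-1)^m modulo p, which is a unit. *)

(** * Differential operators and multiplication by high p-th powers *)

Definition ad (R : comPzRingType) (x : R) (d : R -> R) : R -> R :=
  fun h => d (x * h) - x * d h.

(** Multiplication by x commutes with [ad x], so moving x across d obeys a binomial law. The
    induction on q applies to both d and [ad x d], and Pascal's rule merges the two sums. *)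
Lemma diffop_mulXn (R : comPzRingType) (x : R) q (d : R -> R) h :
  d (x ^+ q * h) =
  \sum_(l < q.+1) (x ^+ (q - l) * iter l (ad x) d h) *+ 'C(q, l).
Proof.
elim: q d => [|q IH] d.
  by rewrite big_ord1 subnn expr0 !mul1r.
have -> : d (x ^+ q.+1 * h) = ad x d (x ^+ q * h) + x * d (x ^+ q * h).
  by rewrite /ad exprS -mulrA subrK.
rewrite !IH mulr_sumr [RHS]big_ord_recl subn0 bin0 /=.
under [in RHS]eq_bigr => i _ do rewrite /bump /= add1n subSS binS mulrnDr.
rewrite big_split /= addrA addrC; congr (_ + _).
  by apply: eq_bigr => i _; rewrite -iterSr.
rewrite big_ord_recl subn0 bin0 /= mulrA -exprS; congr (_ + _).
rewrite big_ord_recr /= bin_small // mulr0n addr0.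
apply: eq_bigr => i _; rewrite /bump /= add1n -mulrnAr mulrA -exprS.
by rewrite -subSn // subSS mulrnAr.
Qed.

Lemma iter_ad_eq0 (R : comPzRingType) (x : R) n l (d : R -> R) :
  diffop_of_order n d -> (n < l)%N -> forall h, iter l (ad x) d h = 0.
Proof.
elim: n l d => [|n IH] [|l] d //= [_ H] ltnl h.
  rewrite -iterS iterSr; elim: l {ltnl} h => [|l IHl] h.
    by rewrite /= /ad H subrr.
  by rewrite /= {1}/ad !IHl mulr0 subr0.
by rewrite -iterS iterSr; apply: IH (H x) _ h.
Qed.

(** With q = p^(n+k), l C(q, l) = q C(q-1, l-1), and the p-adic valuation of l is less than l, hence
    less than n. *)
Lemma dvdn_exp_bin p n k l :
  prime p -> (0 < l <= n)%N -> (p ^ k %| 'C(p ^ (n + k), l))%N.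
Proof.
move=> p_pr /andP[l0 ln]; case: l l0 ln => // l _ ln.
have p1 := prime_gt1 p_pr.
have q0 : (0 < p ^ (n + k))%N by rewrite expn_gt0 prime_gt0.
have lq : (l < p ^ (n + k))%N.
  apply: leq_trans (ltn_expl _ p1) _; apply: leq_pexp2l; first exact: ltnW.
  by rewrite ltnW // (leq_trans ln) // leq_addr.
have C0 : (0 < 'C(p ^ (n + k), l.+1))%N by rewrite bin_gt0.
rewrite pfactor_dvdn //.
have E := mul_bin_diag (p ^ (n + k)) l.
have := congr1 (logn p) E.
rewrite !lognM ?bin_gt0 //; last by rewrite -ltnS prednK.
rewrite pfactorK //.
have : (logn p l.+1 < l.+1)%N by apply: ltn_logl.
lia.
Qed.

(** In the binomial expansion the terms with l > n vanish because d has order n, and those with 0 <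
    l <= n are multiples of p^k. The map [c] into a group killed by p^k allows R itself to be
    torsion-free. *)
Lemma diffop_commute_mod (R : comPzRingType) (V : zmodType)
    (c : {additive R -> V}) (p k n : nat) (d : R -> R) (x h : R) :
  prime p -> (forall v : V, v *+ p ^ k = 0) -> diffop_of_order n d ->
  c (d (x ^+ (p ^ (n + k)) * h)) = c (x ^+ (p ^ (n + k)) * d h).
Proof.
move=> p_pr Vp dn; rewrite diffop_mulXn big_ord_recl subn0 bin0 /= mulr1n.
rewrite raddfD raddf_sum /= big1 ?addr0 // => i _; rewrite /bump /= add1n.
have [le|lt] := leqP i.+1 n; last first.
  by rewrite -iterS (iter_ad_eq0 _ dn) // mulr0 mul0rn raddf0.
have /dvdnP[r ->] := @dvdn_exp_bin p n k i.+1 p_pr le.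
by rewrite raddfMn mulrnA Vp.
Qed.

(** * The recurrence forcing p-torsion *)

(* With r = p - 2, the recurrence makes the entries T (p-1-k) (p-1) k alternate
   in sign, and then T (p-1-k) (p-2) (k+1) is -(k+1) times such an entry;
   at k = p - 1 the latter vanishes. *)
Lemma ternary_recurrence (V : zmodType) (p : nat) (T : nat -> nat -> nat -> V) :
  (1 < p)%N ->
  (forall a b c, T a.+1 b c + T a b.+1 c + T a b c.+1 = 0) ->
  (forall b c, T p b c = 0) -> (forall a c, T a p c = 0) ->
  (forall a b, T a b p = 0) ->
  T p.-1 p.-1 0%N *+ p = 0.
Proof.
case: p => [|[|r]] //= _ rec T1 T2 T3.
have us k : (k <= r)%N -> T (r - k)%N r.+1 k.+1 = - T (r.+1 - k)%N r.+1 k.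
  move=> kr; apply/eqP; rewrite -addr_eq0 addrC subSn //.
  by have := rec (r - k)%N r.+1 k; rewrite T2 addr0 => ->.
have vu k : (k <= r.+1)%N ->
    T (r.+1 - k)%N r k.+1 = - (T (r.+1 - k)%N r.+1 k *+ k.+1).
  elim: k => [_|k IH kr].
    have := rec r.+1 r 0%N; rewrite T1 add0r subn0 mulr1n => /eqP.
    by rewrite addrC addr_eq0 => /eqP.
  have /eqP := rec (r - k)%N r k.+1; rewrite -subSn // (IH (ltnW kr)) subSS.
  rewrite addrC addr_eq0 => /eqP ->; rewrite us // opprD !opprK.
  by rewrite [in RHS]mulNrn opprK [in RHS]mulrSr.
have up k : (k <= r.+1)%N -> T (r.+1 - k)%N r.+1 k *+ r.+2 = 0 ->
    T r.+1 r.+1 0%N *+ r.+2 = 0.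
  elim: k => [|k IH] kr; first by rewrite subn0.
  rewrite subSS us // mulNrn => /eqP; rewrite oppr_eq0 => /eqP.
  exact: IH (ltnW kr).
apply: (up r.+1) => //; apply/eqP; rewrite -oppr_eq0 -vu //.
by rewrite T3.
Qed.

Lemma box_recurrence (V : zmodType) (m p : nat) (i0 i1 i2 : 'I_m)
    (T : 'X_{1..m} -> V) :
  uniq [:: i0; i1; i2] -> (1 < p)%N ->
  (forall j : 'X_{1..m}, \sum_i T (j + U_(i))%MM = 0) ->
  (forall (j : 'X_{1..m}) i, j i = p -> T j = 0) ->
  T [multinom (if i == i2 then 0 else p.-1)%N | i < m] *+ p = 0.
Proof.
rewrite /= !inE negb_or => /and3P[/andP[n01 n02] n12 _] p1 rec T0.
have p0 := ltnW p1.
pose J a b c : 'X_{1..m} := [multinom (if i == i0 then a else if i == i1 then b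
                          else if i == i2 then c else p.-1)%N | i < m].
have -> : [multinom (if i == i2 then 0 else p.-1)%N | i < m] = J p.-1 p.-1 0%N.
  apply/mnmP => i; rewrite !mnmE.
  have [->|] := eqVneq i i0; first by rewrite (negbTE n02).
  by have [->|] := eqVneq i i1; rewrite ?(negbTE n12).
apply: (@ternary_recurrence _ _ (fun a b c => T (J a b c))) => //
  [a b c|b c|a c|a b].
- rewrite -[RHS](rec (J a b c)) (bigD1 i0) //= (bigD1 i1) ?(eq_sym i1) //=.
  rewrite (bigD1 i2) ?(eq_sym i2) ?n02 //= big1 => [|i /andP[/andP[ni0 ni1] ni2]].
    rewrite addr0 addrA; congr (T _ + T _ + T _); apply/mnmP => i; rewrite !mnmE.
    - by case: (eqVneq i i0); rewrite ?addn1 ?addn0.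
    - have [->|] := eqVneq i i1; last by rewrite addn0.
      by rewrite eq_sym (negbTE n01) addn1.
    - have [->|] := eqVneq i i2; last by rewrite addn0.
      by rewrite !(eq_sym i2) (negbTE n02) (negbTE n12) addn1.
  (* Raising any other index takes it from p - 1 to p, where T vanishes. *)
  apply: (T0 _ i); rewrite !mnmE (negbTE ni0) (negbTE ni1) (negbTE ni2) eqxx.
  by rewrite addn1 prednK.
- by apply: (T0 _ i0); rewrite mnmE eqxx.
- by apply: (T0 _ i1); rewrite mnmE eqxx eq_sym (negbTE n01).
- by apply: (T0 _ i2); rewrite mnmE eqxx !(eq_sym i2) (negbTE n02) (negbTE n12).
Qed.

(** * Coefficients of multiples and of Hasse derivatives *)

Lemma mcoeff_mulXn_small (A : comNzRingType) N (i : 'I_N) k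
    (g : {mpoly A[N]}) (b : 'X_{1..N}) :
  (b i < k)%N -> (g * 'X_i ^+ k)@_b = 0.
Proof.
move=> bk; apply/eqP; rewrite mcoeff_eq0 mpolyXn (perm_mem (msuppMX _ _)).
apply/negP => /mapP[b' _ E]; move: bk; rewrite E mnmDE mulmnE mnm1E eqxx; lia.
Qed.

(** Free of the support of s, this formula makes additivity in s immediate. *)
Lemma mcoeff_hasse_partial (K : comNzRingType) N (a b : 'X_{1..N})
    (s : {mpoly K[N]}) :
  (hasse_partial a s)@_b = s@_(a + b) * (\prod_(i < N) 'C(a i + b i, a i))%:R.
Proof.
rewrite /hasse_partial raddf_sum /=.
have F c : c != (a + b)%MM ->
  ((s@_c * (\prod_(i < N) 'C(c i, a i))%:R) *: 'X_[(c - a)%MM])@_b = 0.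
  move=> ne; rewrite mcoeffZ mcoeffX.
  have [E|] := eqVneq (c - a)%MM b; last by rewrite mulr0.
  (* The subtraction [c - a] is truncated, so it may equal b without a <= c; some binomial C(c i, a
     i) is then zero. *)
  have [/forallP le|] := boolP [forall i, a i <= c i]%N.
    case/eqP: ne; apply/mnmP => i; rewrite -E mnmDE mnmBE subnKC //.
  rewrite negb_forall => /existsP[i]; rewrite -ltnNge => lt.
  by rewrite (bigD1 i) //= bin_small // mul0n mulr0 mul0r.
have P : (\prod_(i < N) 'C((a + b)%MM i, a i) = \prod_(i < N) 'C(a i + b i, a i))%N.
  by apply: eq_bigr => i _; rewrite mnmDE.
have [ab|ab] := boolP ((a + b)%MM \in msupp s).
  rewrite (bigD1_seq _ ab) ?msupp_uniq //= [X in _ + X]big1 ?addr0 => [|c /F //].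
  by rewrite mcoeffZ mcoeffX addmC addmK eqxx mulr1 addmC P.
rewrite big_seq [LHS]big1 => [|c cs]; first by rewrite memN_msupp_eq0 ?mul0r.
by apply: F; apply: contraNneq ab => <-.
Qed.

(** * Coefficients and base change on the quotient ring *)

Section QuadricRing.
Variables (A : comNzRingType) (m : nat).

Lemma repr_pi (g : {mpoly A[m + m]}) :
  exists h, repr (\pi_(quadric_ring A m) g) = g + h * quadric A m.
Proof.
have : repr (\pi_(quadric_ring A m) g) - g \in quadric_ideal A m.
  by rewrite Quotient.idealrBE reprK.
by case/quadric_idealP => h E; exists h; rewrite -E addrC subrK.
Qed.

Lemma pi_quadric : \pi_(quadric_ring A m) (quadric A m) = 0.
Proof.
apply/eqP; rewrite -(rmorph0 \pi_(quadric_ring A m)) -Quotient.idealrBE subr0.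
by apply/quadric_idealP; exists 1; rewrite mul1r.
Qed.

(** Read off a chosen representative, this is independent of the choice when b involves no w_i,
    since every monomial of a multiple of f does. *)
Definition coef_quot (b : 'X_{1..m + m}) (a : quadric_ring A m) : A :=
  (repr a)@_b.

Lemma coef_quot_pi (b : 'X_{1..m + m}) g :
  (forall i, b (rshift m i) = 0%N) ->
  coef_quot b (\pi_(quadric_ring A m) g) = g@_b.
Proof.
move=> b0; rewrite /coef_quot; have [h ->] := repr_pi g.
rewrite mcoeffD /quadric mulr_sumr raddf_sum /= big1 ?addr0 // => i _.
by rewrite mulrA -['X_(rshift m i)]expr1 mcoeff_mulXn_small ?b0.
Qed.

Lemma coef_quotB (b : 'X_{1..m + m}) :
  (forall i, b (rshift m i) = 0%N) ->
  {morph coef_quot b : x y / x - y}.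
Proof.
move=> b0 x y; rewrite -(reprK x) -(reprK y) -rmorphB !coef_quot_pi //.
by rewrite raddfB.
Qed.

End QuadricRing.

Lemma map_quadric (A B : comNzRingType) (f : {rmorphism A -> B}) m :
  map_mpoly f (quadric A m) = quadric B m.
Proof.
rewrite /quadric rmorph_sum; apply: eq_bigr => i _.
by rewrite rmorphM /= !map_mpolyX.
Qed.

Lemma pi_map_repr (A B : comNzRingType) (f : {rmorphism A -> B}) m g :
  \pi_(quadric_ring B m) (map_mpoly f (repr (\pi_(quadric_ring A m) g))) =
  \pi_(quadric_ring B m) (map_mpoly f g).
Proof.
have [h ->] := repr_pi g; rewrite rmorphD rmorphM /= map_quadric.
by rewrite rmorphD rmorphM /= pi_quadric mulr0 addr0.
Qed.

(** * Non-divisibility by p *)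

Lemma Zp_natr_eq0 p n : (1 < p)%N -> ((n%:R : 'Z_p) == 0) = (p %| n)%N.
Proof. by move=> p1; rewrite -val_eqE /= val_Zp_nat. Qed.

Lemma prime_ndvd_prod (I : finType) p (F : I -> nat) :
  prime p -> (forall i, ~~ (p %| F i))%N -> ~~ (p %| \prod_i F i)%N.
Proof.
move=> p_pr pF; apply: (big_ind (fun n => ~~ (p %| n)%N)) => // [|a b na nb].
  by rewrite Euclid_dvd1.
by rewrite Euclid_dvdM // negb_or na.
Qed.

(** (p-1)! C(q-1, p-1) is the product of the q - i for 0 < i < p, none of them divisible by p. *)
Lemma prime_ndvd_bin p q :
  prime p -> (0 < q)%N -> (p %| q)%N -> ~~ (p %| 'C(q.-1, p.-1))%N.
Proof.
move=> p_pr q0 pq; have p1 := prime_gt1 p_pr.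
have le_pq := dvdn_leq q0 pq.
apply: contra (@prime_ndvd_prod 'I_p.-1 p (fun i => q.-1 - i)%N p_pr _).
  by move=> /(dvdn_mulr p.-1`!); rewrite bin_ffact ffact_prod.
move=> i; have ltip := ltn_ord i.
have -> : (q.-1 - i = q - i.+1)%N by lia.
rewrite dvdn_subr //; last by lia.
by rewrite gtnNdvd //; lia.
Qed.

(** * The decisive coefficient of the Frobenius trace *)

Section Trace.
Variables (m p q : nat).

(* The exponent of prod_i x_i^(q-p+j_i) w_i^(j_i). *)
Definition box_mon (j : 'X_{1..m}) : 'X_{1..m + m} :=
  [multinom match split k with inl i => (q - p + j i)%N | inr i => j i end
  | k < m + m].

Lemma box_mon_lshift j i : box_mon j (lshift m i) = (q - p + j i)%N.
Proof. by rewrite mnmE (unsplitK (inl i)). Qed.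

Lemma box_mon_rshift j i : box_mon j (rshift m i) = j i.
Proof. by rewrite mnmE (unsplitK (inr i)). Qed.

Lemma box_monP (b : 'X_{1..m + m}) (j : 'X_{1..m}) :
  (forall i, b (lshift m i) = q - p + j i)%N -> (forall i, b (rshift m i) = j i) ->
  b = box_mon j.
Proof.
move=> bl br; apply/mnmP => k; rewrite -(splitK k).
by case: (split k) => i /=; rewrite ?bl ?br ?box_mon_lshift ?box_mon_rshift.
Qed.

Lemma box_monD j i :
  box_mon (j + U_(i)) = (box_mon j + (U_(lshift m i) + U_(rshift m i)))%MM.
Proof.
apply/esym/box_monP => k; rewrite !mnmDE ?box_mon_lshift ?box_mon_rshift !mnm1E.
  by rewrite (inj_eq (@lshift_inj _ _)) eq_rlshift addn0 addnA.
by rewrite (inj_eq (@rshift_inj _ _)) eq_lrshift add0n.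
Qed.

(* In characteristic p, f^p = sum_i x_i^p w_i^p, whereas w_i has exponent p - 1
   in the monomial that Phi sends to x^b. *)
Lemma mcoeff_Phi_quadric_exp (h : {mpoly 'Z_p[m + m]}) (b : 'X_{1..m + m}) :
  prime p -> (forall i, b (rshift m i) = 0%N) ->
  (Phi p (m + m) (h * quadric 'Z_p m ^+ p))@_b = 0.
Proof.
move=> p_pr b0; have p1 := prime_gt1 p_pr.
have pchar : p \in [pchar {mpoly 'Z_p[m + m]}].
  by rewrite inE p_pr /= -mpolyC_nat -(mpolyC0 _ 'Z_p) pchar_Zp.
rewrite mcoeff_hasse_partial -(pFrobenius_autE pchar) rmorph_sum mulr_sumr.
rewrite raddf_sum big1 ?mul0r //= => i _.
rewrite pFrobenius_autE exprMn mulrA mcoeff_mulXn_small //.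
by rewrite mnmDE mnmE b0 addn0 prednK // ltnW.
Qed.

(** [Phi] takes this coefficient from the monomial with all x exponents q - 1 and all w exponents p
    - 1, with weight C(q-1, p-1)^m; that monomial has coefficient 1 in f^(p-1) ['X_[s]]. *)
Lemma coef_frobenius_trace (i2 : 'I_m) : prime p -> (p <= q)%N ->
  coef_quot (box_mon 0) (frobenius_trace p m
    (\pi_(quadric_ring 'Z_p m)
       'X_[box_mon [multinom (if i == i2 then 0 else p.-1)%N | i < m]])) =
  (\prod_(i < m) 'C(q.-1, p.-1))%:R.
Proof.
move=> p_pr pq; have p0 := prime_gt0 p_pr.
have b0 i : box_mon 0 (rshift m i) = 0%N by rewrite box_mon_rshift mnm0E.
rewrite /frobenius_trace coef_quot_pi //.
set s := box_mon [multinom _ | i < m]; have [h ->] := @repr_pi 'Z_p m 'X_[s].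
(* The ambiguity h f of the representative turns into h f^p, which contributes nothing. *)
rewrite mulrDr mulrCA -exprSr prednK //.
have PhiD (g g' : {mpoly 'Z_p[m + m]}) : (Phi p (m + m) (g + g'))@_(box_mon 0) =
    (Phi p (m + m) g)@_(box_mon 0) + (Phi p (m + m) g')@_(box_mon 0).
  by rewrite !mcoeff_hasse_partial mcoeffD mulrDl.
rewrite PhiD mcoeff_Phi_quadric_exp // addr0 mcoeff_hasse_partial.
set b := (_ + _)%MM.
have bl i : b (lshift m i) = q.-1.
  by rewrite mnmDE mnmE box_mon_lshift mnm0E; lia.
have br i : b (rshift m i) = p.-1.
  by rewrite mnmDE mnmE box_mon_rshift mnm0E; lia.
have -> : (\prod_(i < m + m) 'C([multinom p.-1  | _ < m + m] i + box_mon 0 i,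
            [multinom p.-1 | _ < m + m] i) = \prod_(i < m) 'C(q.-1, p.-1))%N.
  rewrite big_split_ord /= [X in (_ * X)%N]big1 ?muln1 => [|i _].
    by apply: eq_bigr => i _; rewrite -mnmDE bl mnmE.
  by rewrite -mnmDE br mnmE binn.
rewrite [X in X * _](_ : _ = 1) ?mul1r //.
pose u : {mpoly 'Z_p[m + m]} := 'X_(lshift m i2) * 'X_(rshift m i2).
pose v : {mpoly 'Z_p[m + m]} :=
  \sum_(i < m | i != i2) 'X_(lshift m i) * 'X_(rshift m i).
(* Only (x_i2 w_i2)^(p-1) contributes: for i != i2 the factor x_i w_i raises the
   exponent of w_i in the monomial s to p. *)
have [w qE] : exists w, quadric 'Z_p m ^+ p.-1 = u ^+ p.-1 + v * w.
  exists (\sum_(k < p.-1) quadric 'Z_p m ^+ (p.-1.-1 - k) * u ^+ k).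
  have -> : v = quadric 'Z_p m - u.
    by rewrite /quadric (bigD1 i2) //= -/u -/v addrAC subrr add0r.
  by rewrite -subrXX addrC subrK.
rewrite qE mulrDl mcoeffD [X in _ + X](_ : _ = 0) ?addr0.
  have -> : u ^+ p.-1 * 'X_[s] = 'X_[b].
    rewrite /u -mpolyXD mpolyXn -mpolyXD; congr 'X_[_].
    apply/mnmP => k; rewrite -(splitK k); case: (split k) => i /=.
      rewrite bl mnmDE mulmnE mnmDE !mnm1E box_mon_lshift mnmE.
      rewrite (inj_eq (@lshift_inj _ _)) eq_rlshift addn0 eq_sym.
      by case: (i == i2); lia.
    rewrite br mnmDE mulmnE mnmDE !mnm1E box_mon_rshift mnmE.
    rewrite (inj_eq (@rshift_inj _ _)) eq_lrshift add0n eq_sym.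
    by case: (i == i2); lia.
  by rewrite mcoeffX eqxx.
rewrite /v !mulr_suml raddf_sum big1 // => i ni /=.
have -> : s = (U_(rshift m i) *+ p.-1 + (s - U_(rshift m i) *+ p.-1))%MM.
  rewrite addmC submK //; apply/mnm_lepP => k; rewrite mulmnE mnm1E.
  case: eqP => [<-|_]; last by rewrite mul0n.
  by rewrite box_mon_rshift mnmE (negbTE ni) mul1n.
rewrite mpolyXD -mpolyXn.
set x := 'X_(lshift m i); set y := 'X_(rshift m i); set z := 'X_[_].
have -> : x * y * w * (y ^+ p.-1 * z) = x * w * z * y ^+ p.
  have -> : y ^+ p = y * y ^+ p.-1 by rewrite -exprS prednK.
  rewrite [x * y * w]mulrAC -[LHS]mulrA -[RHS]mulrA; congr (_ * _).
  by rewrite mulrA mulrC.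
by rewrite mcoeff_mulXn_small // br prednK.
Qed.

End Trace.

(** * Nonexistence of lifts *)

(** This covers A = Z/p^2 and A = Z together: [phi] is reduction modulo p and [psi] reduction modulo
    p^2. The kernel hypothesis turns p T = 0 in Z/p^2 into vanishing modulo p. *)
Lemma frobenius_trace_no_lift (A : comNzRingType) (m p : nat)
    (phi : {rmorphism A -> 'Z_p}) (psi : {additive A -> 'Z_(p ^ 2)})
    (d : quadric_ring A m -> quadric_ring A m) :
  (3 <= m)%N -> prime p -> (forall a, psi a *+ p = 0 -> phi a = 0) ->
  is_diffop d ->
  ~ (forall a, \pi_(quadric_ring 'Z_p m) (map_mpoly phi (repr (d a))) =
       frobenius_trace p m (\pi_(quadric_ring 'Z_p m) (map_mpoly phi (repr a)))).
Proof.
move=> m3 p_pr ker_psi [n dn] lift.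
have p0 := prime_gt0 p_pr; have p1 := prime_gt1 p_pr.
pose q := (p ^ (n + 2))%N.
have q0 : (0 < q)%N by rewrite expn_gt0 p0.
have pq : (p %| q)%N by rewrite -{1}(expn1 p) dvdn_exp2l // addn2.
have le_pq := dvdn_leq q0 pq.
pose b := box_mon p q (0%MM : 'X_{1..m}).
have b0 i : b (rshift m i) = 0%N by rewrite box_mon_rshift mnm0E.
pose c0 a := psi (coef_quot b a).
have c0B : {morph c0 : x y / x - y}.
  by move=> x y; rewrite /c0 coef_quotB // raddfB.
pose c : {additive quadric_ring A m -> 'Z_(p ^ 2)} :=
  HB.pack c0 (GRing.isZmodMorphism.Build _ _ c0 c0B).
have dD : {morph d : x y / x + y}.
  by case: n dn {q q0 pq le_pq b b0 c0 c0B c} => [|n] [].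
have dB : {morph d : x y / x - y}.
  by move=> x y; apply/eqP; rewrite eq_sym subr_eq -dD subrK.
pose d' : {additive quadric_ring A m -> quadric_ring A m} :=
  HB.pack d (GRing.isZmodMorphism.Build _ _ d dB).
pose i0 := Ordinal (leq_trans (isT : 0 < 3)%N m3).
pose i1 := Ordinal (leq_trans (isT : 1 < 3)%N m3).
pose i2 := Ordinal (leq_trans (isT : 2 < 3)%N m3).
pose T j := c (d' (\pi_(quadric_ring A m) 'X_[box_mon p q j])).
have Zp2 (v : 'Z_(p ^ 2)) : v *+ p ^ 2 = 0.
  by rewrite -mulr_natr pchar_Zp ?mulr0 // -{1}(exp1n 2) ltn_exp2r.
have recT (j : 'X_{1..m}) : \sum_i T (j + U_(i))%MM = 0.
  rewrite /T -!raddf_sum; under eq_bigr => i _ do rewrite box_monD !mpolyXD.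
  rewrite [X in d' X](_ : _ = 0) ?raddf0 //=.
  by rewrite -mulr_sumr rmorphM /= pi_quadric mulr0.
have T0 (j : 'X_{1..m}) i : j i = p -> T j = 0.
  move=> ji; pose s := (box_mon p q j - U_(lshift m i) *+ q)%MM.
  have -> : T j =
      c (d (\pi_(quadric_ring A m) 'X_(lshift m i) ^+ q * \pi 'X_[s])).
    rewrite -rmorphXn -rmorphM /= mpolyXn -mpolyXD addmC submK //.
    apply/mnm_lepP => k; rewrite mulmnE mnm1E.
    case: eqP => [<-|_]; last by rewrite mul0n.
    by rewrite box_mon_lshift ji mul1n subnK.
  rewrite (diffop_commute_mod _ _ _ p_pr Zp2 dn) -[d _]reprK -rmorphXn -rmorphM /=.
  (* A multiple of x_i^q has no term at [b], where x_i has exponent q - p. *)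
  rewrite /c0 coef_quot_pi // mulrC mcoeff_mulXn_small ?raddf0 //.
  by rewrite box_mon_lshift mnm0E; lia.
have := @box_recurrence _ m p i0 i1 i2 T isT p1 recT T0.
(* Since [b] involves no w_i, [phi] of this coefficient is the one at [b] of the reduction, hence of
   the trace. *)
move/ker_psi; rewrite /coef_quot -(mcoeff_map_mpoly phi) -(coef_quot_pi _ b0).
rewrite lift pi_map_repr map_mpolyX coef_frobenius_trace // => /eqP.
rewrite Zp_natr_eq0 //; apply/negP/prime_ndvd_prod => // _.
exact: prime_ndvd_bin.
Qed.

(** The coefficient map inside [reduce_sq], named so that it can be shown to be a ring morphism. *)
Definition Zp_of_Zp2 p (c : 'Z_(p ^ 2)) : 'Z_p := (val c)%:R.

Lemma Zp_of_Zp2_nat p k : prime p -> Zp_of_Zp2 (k%:R : 'Z_(p ^ 2)) = k%:R.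
Proof.
move=> p_pr; have p1 := prime_gt1 p_pr.
rewrite /Zp_of_Zp2 /= val_Zp_nat; last by rewrite -{1}(exp1n 2) ltn_exp2r.
apply: val_inj; rewrite /= !val_Zp_nat // modn_dvdm //.
by rewrite -{1}(expn1 p) dvdn_exp2l.
Qed.

Theorem theorem6p1 (m p : nat) :
  (3 <= m)%N -> prime p ->
  ~ (exists d : quadric_ring 'Z_(p ^ 2) m -> quadric_ring 'Z_(p ^ 2) m,
        is_diffop d /\
        forall a, reduce_sq p m (d a) = frobenius_trace p m (reduce_sq p m a))
  /\
  ~ (exists d : quadric_ring int m -> quadric_ring int m,
        is_diffop d /\
        forall a, reduce_int p m (d a) = frobenius_trace p m (reduce_int p m a)).
Proof.
move=> m3 p_pr; have p1 := prime_gt1 p_pr; have p0 := ltnW p1.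
have p21 : (1 < p ^ 2)%N by rewrite -{1}(exp1n 2) ltn_exp2r.
have dvdp2 k : (p ^ 2 %| k * p)%N -> (p %| k)%N by rewrite expnS dvdn_pmul2r.
split=> -[d [dd lift]].
- pose f := @Zp_of_Zp2 p.
  have fE k : f k%:R = k%:R by apply: Zp_of_Zp2_nat.
  (* Every residue is the image of a natural number, so [fE] gives the morphism laws. *)
  have fB : {morph f : x y / x - y}.
    move=> x y; apply/eqP; rewrite eq_sym subr_eq; apply/eqP.
    rewrite -{1}(subrK y x) -(natr_Zp (x - y)) -(natr_Zp y).
    by rewrite -natrD !fE natrD.
  have fM : monoid_morphism f.
    split=> [|x y]; first exact: (fE 1%N).
    by rewrite -(natr_Zp x) -(natr_Zp y) -natrM !fE natrM.
  pose phi : {rmorphism 'Z_(p ^ 2) -> 'Z_p} :=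
    HB.pack f (GRing.isZmodMorphism.Build _ _ f fB)
      (GRing.isMonoidMorphism.Build _ _ f fM).
  apply: (@frobenius_trace_no_lift _ m p phi idfun d) => // a /=.
  rewrite -{1}(natr_Zp a) -mulrnA => /eqP.
  rewrite Zp_natr_eq0 // => /dvdp2 pa.
  by apply/eqP; rewrite /f /Zp_of_Zp2 Zp_natr_eq0.
- apply: (@frobenius_trace_no_lift _ m p intr intr d) => // a /=.
  have nat_case k : (k%:R : 'Z_(p ^ 2)) *+ p = 0 -> (k%:R : 'Z_p) = 0.
    rewrite -mulrnA => /eqP; rewrite Zp_natr_eq0 // => /dvdp2 pk.
    by apply/eqP; rewrite Zp_natr_eq0.
  case: (intP a) => [|k|k]; rewrite ?mulr0z // ?mulrNz ?mulNrn.
    exact: nat_case.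
  move=> /eqP; rewrite oppr_eq0 => /eqP /nat_case k0.
  by apply/eqP; rewrite oppr_eq0; apply/eqP.
Qed.
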